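(* Let $\mathcal{X}_1,\mathcal{X}_2$ be metric spaces having the input-EDAP (with $\mathbb{K}=\mathbb{R}$) with encoders $E_n^{(1)}$ and $E_n^{(2)}$ ($n\in\mathbb{N}$), respectively. Let $\mathcal{F}$ be a universal function approximator (with $\mathbb{K}=\mathbb{R}$) and let $S$ be a dense subset of a real Banach space $\mathcal{Y}$. Then for every continuous $G:\mathcal{X}_1\times\mathcal{X}_2\to\mathcal{Y}$ and every compact $K\subseteq\mathcal{X}_1\times\mathcal{X}_2$ there exist, for each $n\in\mathbb{N}$, a number $p_n\in\mathbb{N}$, functions $\varphi_n^{(1)},\varphi_n^{(2)}\in\mathcal{F}$ with values in $\mathbb{R}^{p_n}$ (defined on the target spaces of $E_n^{(1)}$ and $E_n^{(2)}$, respectively) and $\psi_{n,1},\dots,\psi_{n,p_n}\in S$ such that $$\sup_{(f_1,f_2)\in K}\left\Vert G(f_1,f_2)-\sum_{i=1}^{p_n}\varphi_{n,i}^{(1)}\big(E_n^{(1)}(f_1)\big)\,\varphi_{n,i}^{(2)}\big(E_n^{(2)}(f_2)\big)\,\psi_{n,i}\right\Vert\xrightarrow{n\to\infty}0,$$ where $\varphi_{n,i}^{(1)}$ and $\varphi_{n,i}^{(2)}$ denote the $i$-th output coordinates of $\varphi_n^{(1)}$ and $\varphi_n^{(2)}$, respectively. (The $p_n,\varphi_n^{(1)},\varphi_n^{(2)},\psi_{n,i}$ may depend on $K$.)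
   Context: $\mathcal{X}_1\times\mathcal{X}_2$ carries the product topology; $|\cdot|$ is the Euclidean norm. Input-EDAP (with $\mathbb{K}=\mathbb{R}$): a metric space $(\mathcal{X},d)$ has the input-EDAP if there are mappings $E_n:\mathcal{X}\to\mathbb{R}^{w(n)}$ (encoders, possibly discontinuous, $w(n)\in\mathbb{N}$) and $D_n:\overline{E_n(\mathcal{X})}\to\mathcal{X}$ (decoders), $n\in\mathbb{N}$, such that: (i) there is $r:\mathbb{N}\to(0,\infty)$ such that for each compact $K\subseteq\mathcal{X}$ there is $N_K\in\mathbb{N}$ with $\sup_{f\in K}|E_n(f)|\le r(n)$ for all $n\ge N_K$; (ii) each $D_n$ is continuous; (iii) for every compact $K\subseteq\mathcal{X}$, $\sup_{f\in K} d(f,D_n(E_n(f)))\to0$ as $n\to\infty$. ''With encoders $E_n$'' means that the $E_n$ together with some decoders $D_n$ satisfy this definition. Universal function approximator (with $\mathbb{K}=\mathbb{R}$): a set $\mathcal{F}$ of functions $\mathbb{R}^a\to\mathbb{R}^b$ (with varying $a,b\in\mathbb{N}$; members may be discontinuous) such that for any $a,b\in\mathbb{N}$, compact $C\subset\mathbb{R}^a$ and continuous $f:C\to\mathbb{R}^b$ there is a sequence $(f_n)_{n\in\mathbb{N}}$ of functions $\mathbb{R}^a\to\mathbb{R}^b$ in $\mathcal{F}$ with $\sup_{x\in C}|f(x)-f_n(x)|\to0$. *)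

(* Defs.v *)
From HB Require Import structures.
From mathcomp Require Import all_boot all_order all_algebra.
From mathcomp Require Import all_classical all_reals all_analysis.

Set Implicit Arguments.
Unset Strict Implicit.
Unset Printing Implicit Defensive.

Import Order.TTheory GRing.Theory Num.Theory.
Import numFieldNormedType.Exports.

Local Open Scope classical_set_scope.
Local Open Scope ring_scope.

(* The library norm on 'rV[R]_n is the maximum norm; it induces the same
   topology as the Euclidean norm. *)
Definition enorm (R : realType) (n : nat) (x : 'rV[R]_n) : R :=
  Num.sqrt (\sum_(i < n) x ord0 i ^+ 2).

(* Supremum over A of a nonnegative function, taken in [0, +oo]; in particular
   the supremum over the empty set is 0, whereas ereal_sup set0 is -oo. *)
Definition sup_over (R : realType) (T : Type) (A : set T) (g : T -> R) : \bar R :=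
  ereal_sup (0%E |` [set (g x)%:E | x in A]).

Definition to_closure_range (T : Type) (U : topologicalType) (E : T -> U)
    (f : T) : closure (range E) :=
  exist _ (E f) (mem_set (subset_closure (imageT E f))).

(* Dimensions of Euclidean spaces range over the positive integers, here and
   in universal_approximator. The decoder D n is defined on the closure of the
   range of E n only, with the subspace topology (carried by the coercion of a
   set to a type). *)
Definition input_EDAP_with (R : realType) (X : metricType R) (w : nat -> nat)
    (E : forall n, X -> 'rV[R]_(w n)) : Prop :=
  (forall n, (0 < w n)%N) /\
  exists D : forall n, closure (range (E n)) -> X,
    [/\ exists2 r : nat -> R, forall n, 0 < r n &
          forall K : set X, compact K -> exists NK : nat,
            forall n, (NK <= n)%N ->
              (sup_over K (fun f => enorm (E n f)) <= (r n)%:E)%E,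
        forall n, continuous (D n) &
        forall K : set X, compact K ->
          sup_over K (fun f => mdist f (D n (to_closure_range (E n) f)))
            @[n --> \oo] --> 0%E].

Definition universal_approximator (R : realType)
    (F : forall a b : nat, set ('rV[R]_a -> 'rV[R]_b)) : Prop :=
  forall (a b : nat), (0 < a)%N -> (0 < b)%N ->
  forall (C : set 'rV[R]_a) (f : 'rV[R]_a -> 'rV[R]_b),
    compact C -> {within C, continuous f} ->
    exists2 g : nat -> 'rV[R]_a -> 'rV[R]_b,
      forall n, F a b (g n) &
      sup_over C (fun x => enorm (f x - g n x)) @[n --> \oo] --> 0%E.

(* Main.v *)
(* On K, G is uniformly close to G o (D1_n o E1_n, D2_n o E2_n). On compact sets
   L1, L2 partitions of unity give G(x1, x2) = sum_i a_i(x1) b_i(x2) y_i up to a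
   given error; taking for L1, L2 the images under the decoders of the closed
   ranges of the encoders cut off at radius r(n), the functions a_i o D1_n and
   b_i o D2_n are continuous on compact subsets of Euclidean spaces, where F
   approximates them, and the y_i are replaced by elements of S. This is done for
   each n separately with error 1/(n+1), so no diagonal argument is needed. *)
Require Import Defs.
From HB Require Import structures.
From mathcomp Require Import all_boot all_order all_algebra.
From mathcomp Require Import all_classical all_reals all_analysis ring lra.

Set Implicit Arguments.
Unset Strict Implicit.
Unset Printing Implicit Defensive.

Import Order.TTheory GRing.Theory Num.Theory.
Import numFieldNormedType.Exports.

Local Open Scope classical_set_scope.
Local Open Scope ring_scope.

(** * Suprema in [0, +oo] and norms of row vectors *)

Lemma le_sup_over (R : realType) (T : Type) (A : set T) (g : T -> R) x :
  A x -> ((g x)%:E <= sup_over A g)%E.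
Proof. by move=> Ax; apply: ereal_sup_ubound; right; exists x. Qed.

Lemma sup_over_le (R : realType) (T : Type) (A : set T) (g : T -> R) (e : R) :
  0 <= e -> (forall x, A x -> g x <= e) -> (sup_over A g <= e%:E)%E.
Proof.
move=> e0 gAe; apply: ge_ereal_sup => _ [->|[x Ax <-]]; rewrite lee_fin //.
exact: gAe.
Qed.

(** Convergence to 0 makes the suprema finite only eventually. Conversely, they are nonnegative
    because 0 is adjoined, so a uniform upper bound makes them finite. *)
Lemma sup_over_cvg0P (R : realType) (T : Type) (A : set T) (g : nat -> T -> R) :
  sup_over A (g n) @[n --> \oo] --> 0%E <->
  forall e, 0 < e -> \forall n \near \oo, forall x, A x -> g n x <= e.
Proof.
have sup_ge0 n : (0 <= sup_over A (g n))%E by apply: ereal_sup_ubound; left.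
split=> [/fine_cvgP[gfin /cvgr0Pnorm_lt ge] e e0|ge].
  near=> n => x Ax; rewrite -lee_fin (le_trans (le_sup_over _ Ax)) //.
  have supfin : sup_over A (g n) \is a fin_num by near: n.
  rewrite -(fineK supfin) lee_fin (le_trans (ler_norm _)) //.
  by apply: ltW; near: n; exact: ge.
have supe e : 0 < e -> \forall n \near \oo, (sup_over A (g n) <= e%:E)%E.
  by move=> e0; near=> n; apply: sup_over_le (ltW e0) _; near: n; exact: ge.
have supfin : \forall n \near \oo, sup_over A (g n) \is a fin_num.
  near=> n; rewrite ge0_fin_numE //; apply: (@le_lt_trans _ _ 1%:E).
    by near: n; exact: supe.
  exact: ltry.
apply/fine_cvgP; split=> //; apply/cvgr0Pnorm_le => e e0; near=> n.
rewrite ger0_norm ?fine_ge0 // -lee_fin fineK; last by near: n.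
by near: n; exact: supe.
Unshelve. all: by end_near. Qed.

Lemma normr_coord_le_enorm (R : realType) (n : nat) (x : 'rV[R]_n) i :
  `|x ord0 i| <= enorm x.
Proof.
rewrite -sqrtr_sqr ler_sqrt ?sumr_ge0 // => [|j _]; last exact: sqr_ge0.
by rewrite (bigD1 i) //= lerDl sumr_ge0 // => j _; exact: sqr_ge0.
Qed.

Lemma normr_le_enorm (R : realType) (n : nat) (x : 'rV[R]_n) : `|x| <= enorm x.
Proof.
rewrite [leLHS]/Num.norm /= mx_normrE; apply/bigmax_leP; split=> [|[i j] _].
  exact: sqrtr_ge0.
by rewrite ord1; exact: normr_coord_le_enorm.
Qed.

(** * Compactness in metric spaces and partitions of unity *)

(** Only [x] has to lie in [K]: later [y] is a pair of decoded points or of centres, which may lie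
    outside. The near-covering form of compactness, applied to radii tending to 0 from the right,
    yields one radius for all of [K]. *)
Lemma compact_continuous_ball (R : realType) (X Y : pseudoMetricType R)
    (K : set X) (G : X -> Y) (e : R) :
  compact K -> {in K, continuous G} -> 0 < e ->
  exists2 d, 0 < d & forall x y, K x -> ball x d y -> ball (G x) e (G y).
Proof.
move=> /compact_near_coveringP cK cG e0.
have : \forall d \near (0 : R)^'+,
    K `<=` [set x | forall y, ball x d y -> ball (G x) e (G y)].
  apply: cK => x Kx.
  have : nbhs x (fun y => ball (G x) (e / 2) (G y)).
    by apply: cG; [exact/mem_set|apply: nbhsx_ballx; rewrite divr_gt0].
  move=> /nbhs_ballP[r /= r0 xr]; exists (ball x (r / 2), [set d | d < r / 2]).
    split=> /=; first by apply: nbhsx_ballx; rewrite divr_gt0.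
    by apply: nbhs_right_lt; rewrite divr_gt0.
  move=> [x' d] /= [xx' dr] y x'y.
  have xy : ball x r y.
    rewrite (splitr r); apply: ball_triangle xx' _.
    by apply: le_ball x'y; exact: ltW.
  apply: ball_splitr (xr y xy); apply: xr.
  by apply: le_ball xx'; rewrite ler_pdivrMr // ler_peMr ?ltW // ltr1n.
move=> Kd; near (0 : R)^'+ => d; exists d => // x y Kx.
by move: y; apply: (near Kd d).
Unshelve. all: by end_near. Qed.

Lemma compact_finite_net (R : realType) (X : pseudoMetricType R) (L : set X)
    (d : R) :
  compact L -> 0 < d ->
  exists m (t : 'I_m -> X), forall x, L x -> exists i, ball (t i) d x.
Proof.
move=> /compact_near_coveringP cL d0.
(* Finite lists are directed by inclusion. Near-covering along this filter takes the place of
   extracting a finite subcover. *)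
pose F : set_system (seq X) :=
  filter_from setT (fun s0 : seq X => [set s : seq X | {subset s0 <= s}]).
have FF : Filter F.
  apply: filter_from_filter; first by exists [::].
  move=> s1 s2 _ _; exists (s1 ++ s2) => // s sub; split=> x xs; apply: sub;
    by rewrite mem_cat xs ?orbT.
have [s _ Ls] : \forall s \near F, L `<=` [set x | exists2 t, t \in s & ball t d x].
  apply: cL => x Lx; exists (ball x d, [set s : seq X | x \in s]).
    split=> /=; first exact: nbhsx_ballx.
    by exists [:: x] => // s; apply; rewrite mem_seq1.
  by move=> [x' s] /= [xx' xs]; exists x.
exists (size s), (tnth (in_tuple s)) => x /(Ls s)[]// t ts tx.
by have /(tnthP (in_tuple s))[i ti] := ts; exists i; rewrite -ti.
Qed.

Lemma mdist_continuous (R : realType) (X : metricType R) (t : X) :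
  continuous (fun x => mdist t x).
Proof.
move=> x; apply/cvgrPdist_lt => e e0; near=> y.
have xy : mdist x y < e.
  have : ball x e y by near: y; exact: nbhsx_ballx.
  by rewrite ballEmdist.
rewrite ltr_norml; apply/andP; split.
  have := metric_triangle t x y; lra.
have := metric_triangle t y x; rewrite (metric_sym y x); lra.
Unshelve. all: by end_near. Qed.

(* The [a i] are normalized bumps; outside [L] all the bumps may vanish, and then
   [a i x = 0 / 0 = 0]. *)
Lemma compact_partition_unity (R : realType) (X : metricType R) (L : set X)
    (d : R) :
  compact L -> 0 < d ->
  exists m (t : 'I_m -> X) (a : 'I_m -> X -> R),
    [/\ forall i, {in L, continuous (a i)},
        forall i x, 0 <= a i x <= 1,
        forall i x, a i x != 0 -> ball x d (t i) &
        forall x, L x -> \sum_(i < m) a i x = 1].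
Proof.
move=> cL d0; have [m [t tL]] := compact_finite_net cL d0.
pose u i x : R := Num.max 0 (d - mdist (t i) x).
have u0 i x : 0 <= u i x by rewrite le_max lexx.
have cu i : continuous (u i).
  move=> x; apply: (@continuous_max _ _ (fun=> 0) (fun x => d - mdist (t i) x)).
    exact: cvg_cst.
  by apply: cvgB; [exact: cvg_cst|exact: mdist_continuous].
pose U x := \sum_(i < m) u i x.
have U0 x : 0 <= U x by exact: sumr_ge0.
(* A point of [L] is closer than [d] to some centre, whose bump is then positive. *)
have UL x : L x -> U x != 0.
  move=> /tL[i]; rewrite ballEmdist /= => tix; apply: lt0r_neq0.
  rewrite /U (bigD1 i) //= ltr_pwDl ?sumr_ge0 //.
  by rewrite lt_max subr_gt0 tix orbT.
exists m, t, (fun i x => u i x / U x); split=> [i x /set_mem Lx|i x|i x|x Lx].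
- apply: cvgM; first exact: cu.
  apply: cvgV; first exact: UL.
  apply: (@cvg_big _ _ +%R 0 xpredT) => [|i0 _]; [exact: add_continuous|exact: cu].
- rewrite divr_ge0 //=; have [Ux0|Ux0] := eqVneq (U x) 0.
    by rewrite Ux0 invr0 mulr0.
  rewrite ler_pdivrMr ?lt0r ?Ux0 ?U0 // mul1r /U (bigD1 i) //= lerDl.
  exact: sumr_ge0.
- move=> uix; apply: ball_sym; rewrite ballEmdist /= -subr_gt0.
  rewrite ltNge; apply: contraNN uix => /max_idPl.
  by rewrite /u => ->; rewrite mul0r.
- by rewrite -mulr_suml divff // UL.
Qed.

(** * Approximation by finite sums of products in separate variables *)

Lemma continuous_row (R : realType) (T : topologicalType) (n : nat)
    (a : 'I_n -> T -> R) (x : T) :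
  (forall i, {for x, continuous (a i)}) ->
  {for x, continuous (fun x => \row_i a i x : 'rV[R]_n)}.
Proof.
move=> ca; apply/cvgrPdist_le => e e0; near=> y.
rewrite [leLHS]/Num.norm /= mx_normrE; apply/bigmax_leP; split=> [|[i j] _].
  exact: ltW.
rewrite !mxE /=; move: j; near: y.
by apply: filter_forall => j; move: e e0; apply/cvgrPdist_le; exact: ca.
Unshelve. all: by end_near. Qed.

(** The products of the two partitions of unity sum to 1 on the product of [L1] and [L2], and [y]
    collects the values of [G] at pairs of centres. The bounds by 1 are kept for
    [norm_scale_perturb]. *)
Lemma separated_approx (R : realType) (X1 X2 : metricType R)
    (Y : normedModType R) (G : X1 * X2 -> Y) (L1 : set X1) (L2 : set X2)
    (e : R) :
  compact L1 -> compact L2 -> L1 !=set0 -> L2 !=set0 -> continuous G -> 0 < e ->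
  exists m (a : X1 -> 'rV[R]_m) (b : X2 -> 'rV[R]_m) (y : 'I_m -> Y),
    [/\ (0 < m)%N,
        {in L1, continuous a} /\ {in L2, continuous b},
        forall x i, `|a x ord0 i| <= 1,
        forall x i, `|b x ord0 i| <= 1 &
        forall x1 x2, L1 x1 -> L2 x2 ->
          `|G (x1, x2) - \sum_(i < m) (a x1 ord0 i * b x2 ord0 i) *: y i| <= e].
Proof.
move=> cL1 cL2 [z1 Lz1] [z2 Lz2] cG e0.
have [d d0 Gd] : exists2 d, 0 < d & forall x y, (L1 `*` L2) x -> ball x d y ->
    ball (G x) e (G y).
  by apply: compact_continuous_ball e0; [exact: compact_setX|move=> x _; exact: cG].
have [m1 [t1 [a [ca a01 at1 a1]]]] := compact_partition_unity cL1 d0.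
have [m2 [t2 [b [cb b01 bt2 b1]]]] := compact_partition_unity cL2 d0.
(* Pairs of centres are enumerated by a single index, as coordinates of a row vector require. *)
pose I := ('I_m1 * 'I_m2)%type.
pose v (i : 'I_#|{: I}|) : I := enum_val i.
have sum_v (V : nmodType) (f : 'I_m1 -> 'I_m2 -> V) :
    \sum_i f (v i).1 (v i).2 = \sum_j \sum_k f j k.
  by rewrite pair_big -(big_enum_val (fun p : I => f p.1 p.2)); exact: eq_bigl.
exists #|{: I}|, (fun x => \row_i a (v i).1 x), (fun x => \row_i b (v i).2 x),
  (fun i => G (t1 (v i).1, t2 (v i).2)); split.
(* Without any pair, the sum of the weights at [(z1, z2)] would be 0 instead of 1. *)
- rewrite lt0n; apply/negP => /eqP I0.
  have := sum_v _ (fun j k => a j z1 * b k z2).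
  rewrite big1 => [|i _]; last by have := ltn_ord i; rewrite {2}I0.
  under [in RHS]eq_bigr do rewrite -mulr_sumr b1 // mulr1.
  by rewrite a1 // => /esym/eqP; rewrite oner_eq0.
- split=> x Lx; apply: continuous_row => i; first exact: ca.
  exact: cb.
- by move=> x i; rewrite mxE; have /andP[? ?] := a01 (v i).1 x; rewrite ger0_norm.
- by move=> x i; rewrite mxE; have /andP[? ?] := b01 (v i).2 x; rewrite ger0_norm.
move=> x1 x2 Lx1 Lx2; under eq_bigr do rewrite !mxE.
rewrite (sum_v _ (fun j k => (a j x1 * b k x2) *: G (t1 j, t2 k))).
(* Both [G (x1, x2)] and [e] become averages with the same weights, so that the comparison is
   termwise. *)
have -> : G (x1, x2) = \sum_j \sum_k (a j x1 * b k x2) *: G (x1, x2).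
  under eq_bigr do rewrite -scaler_suml -mulr_sumr b1 // mulr1.
  by rewrite -scaler_suml a1 // scale1r.
have -> : e = \sum_j \sum_k (a j x1 * b k x2) * e.
  under eq_bigr do rewrite -mulr_suml -mulr_sumr b1 // mulr1.
  by rewrite -mulr_suml a1 // mul1r.
rewrite -sumrB (le_trans (ler_norm_sum _ _ _)) //; apply: ler_sum => j _.
rewrite -sumrB (le_trans (ler_norm_sum _ _ _)) //; apply: ler_sum => k _.
have /andP[aj0 _] := a01 j x1; have /andP[bk0 _] := b01 k x2.
rewrite -scalerBr normrZ ger0_norm ?mulr_ge0 //.
(* A nonzero weight forces both centres to be within [d], where [Gd] applies. *)
have [->|aj] := eqVneq (a j x1) 0; first by rewrite !mul0r.
have [->|bk] := eqVneq (b k x2) 0; first by rewrite mulr0 !mul0r.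
rewrite ler_wpM2l ?mulr_ge0 // ltW //.
have := Gd (x1, x2) (t1 j, t2 k) (conj Lx1 Lx2) (conj (at1 _ _ aj) (bt2 _ _ bk)).
by rewrite -ball_normE.
Qed.

(** * Replacing the factors by members of [F] and the vectors by elements of [S] *)

Lemma universal_approximator_le (R : realType)
    (F : forall a b : nat, set ('rV[R]_a -> 'rV[R]_b)) (a b : nat)
    (C : set 'rV[R]_a) (f : 'rV[R]_a -> 'rV[R]_b) (e : R) :
  universal_approximator F -> (0 < a)%N -> (0 < b)%N ->
  compact C -> {within C, continuous f} -> 0 < e ->
  exists2 g, F a b g & forall x i, C x -> `|f x ord0 i - g x ord0 i| <= e.
Proof.
move=> hF a0 b0 cC cf e0; have [g Fg /sup_over_cvg0P/(_ _ e0) ge] := hF _ _ a0 b0 _ _ cC cf.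
have [n gn] := filter_ex ge; exists (g n) => // x i Cx.
have := normr_coord_le_enorm (f x - g n x) i; rewrite !mxE => /le_trans; apply.
exact: gn.
Qed.

Lemma dense_norm_le (R : realType) (Y : normedModType R) (S : set Y) (y : Y)
    (e : R) :
  dense S -> 0 < e -> exists2 s, S s & `|y - s| <= e.
Proof.
move=> dS e0; have [||s [ys Ss]] := dS (ball y e).
- by exists y; exact: ballxx.
- exact: ball_open.
by exists s => //; move: ys; rewrite -ball_normE => /ltW.
Qed.

(** Telescoping changes one factor at a time. As [h <= 1], both [a'] and [b'] are at most 2 in
    absolute value, so the three terms cost [h * |y|], [2 * h * |y|] and [4 * h]. *)
Lemma norm_scale_perturb (R : realType) (Y : normedModType R)
    (a b a' b' h : R) (y y' : Y) :
  `|a| <= 1 -> `|b| <= 1 -> h <= 1 ->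
  `|a - a'| <= h -> `|b - b'| <= h -> `|y - y'| <= h ->
  `|(a * b) *: y - (a' * b') *: y'| <= h * (3 * `|y| + 4).
Proof.
move=> a1 b1 h1 aa bb yy.
have h0 : 0 <= h by exact: le_trans aa.
have a2 : `|a'| <= 2.
  by have := ler_normB a (a - a'); rewrite opprB addrCA subrr addr0; lra.
have b2 : `|b'| <= 2.
  by have := ler_normB b (b - b'); rewrite opprB addrCA subrr addr0; lra.
have -> : (a * b) *: y - (a' * b') *: y' =
    ((a - a') * b) *: y + (a' * (b - b')) *: y + (a' * b') *: (y - y').
  rewrite scalerBr addrA -!scalerDl; congr (_ *: _ - _); ring.
apply: le_trans (ler_normD _ _) _; apply: le_trans (lerD (ler_normD _ _) (lexx _)) _.
rewrite !normrZ ?normrM.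
have := ler_pM (normr_ge0 _) (normr_ge0 _) aa b1.
have := ler_pM (normr_ge0 _) (normr_ge0 _) a2 bb.
have := ler_pM (normr_ge0 _) (normr_ge0 _) a2 b2.
have := normr_ge0 y; move: (`|y|) => Y0.
move=> Y0ge p1 p2 p3.
have p4 := ler_pM (mulr_ge0 (normr_ge0 a') (normr_ge0 b')) (normr_ge0 _) p1 yy.
nra.
Qed.

Lemma separated_approximator (R : realType) (X1 X2 : metricType R)
    (w1 w2 : nat) (F : forall a b : nat, set ('rV[R]_a -> 'rV[R]_b))
    (Y : normedModType R) (S : set Y) (G : X1 * X2 -> Y)
    (C1 : set 'rV[R]_w1) (C2 : set 'rV[R]_w2)
    (D1 : 'rV[R]_w1 -> X1) (D2 : 'rV[R]_w2 -> X2) (e : R) :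
  universal_approximator F -> dense S -> continuous G ->
  (0 < w1)%N -> (0 < w2)%N -> compact C1 -> compact C2 ->
  C1 !=set0 -> C2 !=set0 ->
  {within C1, continuous D1} -> {within C2, continuous D2} -> 0 < e ->
  exists p (phi1 : 'rV[R]_w1 -> 'rV[R]_p) (phi2 : 'rV[R]_w2 -> 'rV[R]_p)
      (psi : 'I_p -> Y),
    [/\ (0 < p)%N, F w1 p phi1 /\ F w2 p phi2, forall i, S (psi i) &
        forall x1 x2, C1 x1 -> C2 x2 ->
          `|G (D1 x1, D2 x2) -
            \sum_(i < p) (phi1 x1 ord0 i * phi2 x2 ord0 i) *: psi i| <= e].
Proof.
move=> hF dS cG w10 w20 cC1 cC2 [z1 Cz1] [z2 Cz2] cD1 cD2 e0.
have e20 : 0 < e / 2 by rewrite divr_gt0.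
have L1c := continuous_compact cD1 cC1; have L2c := continuous_compact cD2 cC2.
have [||p [a [b [y [p0 [ca cb] a1 b1 Gab]]]]] :=
  separated_approx L1c L2c _ _ cG e20.
- by exists (D1 z1), z1.
- by exists (D2 z2), z2.
pose M := \sum_(i < p) (3 * `|y i| + 4).
have M0 : 0 <= M by apply: sumr_ge0 => i _; have := normr_ge0 (y i); lra.
have [h [h0 h1 hM]] : exists h, [/\ 0 < h, h <= 1 & h * M <= e / 2].
  (* [M] sums the constants of [norm_scale_perturb] over all terms; [M + 1] is a positive
     denominator. *)
  exists (Num.min 1 (e / 2 / (M + 1))); split.
  - by rewrite lt_min ltr01 divr_gt0 // ltr_wpDl.
  - by rewrite ge_min lexx.
  rewrite (@le_trans _ _ (e / 2 / (M + 1) * M)) ?ler_wpM2r ?ge_min ?lexx ?orbT //.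
  by rewrite mulrAC ler_pdivrMr ?ltr_wpDl // ler_pM2l // lerDl.
have [phi1 F1 phi1a] :=
  universal_approximator_le hF w10 p0 cC1 (within_continuous_comp _ _ _ ca cD1) h0.
have [phi2 F2 phi2b] :=
  universal_approximator_le hF w20 p0 cC2 (within_continuous_comp _ _ _ cb cD2) h0.
have /choice[psi psiP] : forall i, exists s, S s /\ `|y i - s| <= h.
  by move=> i; have [s ? ?] := dense_norm_le (y i) dS h0; exists s.
exists p, phi1, phi2, psi; split=> // [i|x1 x2 Cx1 Cx2]; first by have [] := psiP i.
have GD : `|G (D1 x1, D2 x2) -
    \sum_(i < p) (a (D1 x1) ord0 i * b (D2 x2) ord0 i) *: y i| <= e / 2.
  by apply: Gab; [exists x1|exists x2].
apply: le_trans (ler_distD _ _ _) _; rewrite (splitr e); apply: lerD GD _.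
rewrite -sumrB (le_trans (ler_norm_sum _ _ _)) // (le_trans _ hM) // mulr_sumr.
apply: ler_sum => i _; apply: norm_scale_perturb => //; first exact: phi1a.
  exact: phi2b.
by have [] := psiP i.
Qed.

(** * Dependent choice, extended decoders and truncated encoder ranges *)

(** The types of [phi1 n], [phi2 n] and [psi n] depend on the chosen [p n]. *)
Lemma dep_choice (I : Type) (T : I -> Type) (P : forall i, T i -> Prop) :
  (forall i, exists x, P i x) -> exists f, forall i, P i (f i).
Proof. by move=> /(_ _)/cid Pf; exists (fun i => sval (Pf i)) => i; case: Pf. Qed.

(** Members of [F] live on the whole Euclidean space, so decoders are extended by the constant [x0];
    encoded points do not see the extension. *)
Lemma valL_to_closure_range (T X : Type) (U : topologicalType) (x0 : X)
    (E : T -> U) (D : closure (range E) -> X) (f : T) :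
  'valL_x0 D (E f) = D (to_closure_range E f).
Proof. exact: (congr1 (@^~ (to_closure_range E f)) (valLK x0 D)). Qed.

(* The radius is enlarged so that [E z] always belongs to the set. *)
Definition truncated_range (R : realType) (T : Type) (n : nat)
    (E : T -> 'rV[R]_n) (r : R) (z : T) : set 'rV[R]_n :=
  closure (range E) `&` [set x | `|x| <= Num.max r `|E z|].

Lemma compact_truncated_range (R : realType) (T : Type) (n : nat)
    (E : T -> 'rV[R]_n) (r : R) (z : T) :
  compact (truncated_range E r z).
Proof.
apply: bounded_closed_compact.
  exists (Num.max r `|E z|); split; first exact: num_real.
  by move=> M rM x [_ /= xr]; apply: le_trans xr (ltW rM).
apply: closedI; first exact: closed_closure.
exact: (closed_comp (fun x _ => @norm_continuous _ _ x) (@closed_le _ _)).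
Qed.

Lemma mem_truncated_range (R : realType) (T : Type) (n : nat)
    (E : T -> 'rV[R]_n) (r : R) (z f : T) :
  `|E f| <= r -> truncated_range E r z (E f).
Proof.
move=> Efr; split; first by apply: subset_closure; exists f.
by rewrite /= le_max Efr.
Qed.

Lemma truncated_range_nonempty (R : realType) (T : Type) (n : nat)
    (E : T -> 'rV[R]_n) (r : R) (z : T) : truncated_range E r z !=set0.
Proof.
exists (E z); split; first by apply: subset_closure; exists z.
by rewrite /= le_max lexx orbT.
Qed.

Lemma truncated_range_continuous (R : realType) (T : topologicalType) (n : nat)
    (E : T -> 'rV[R]_n) (r : R) (z : T) (D : closure (range E) -> T) :
  continuous D -> {within truncated_range E r z, continuous 'valL_z D}.
Proof.
move=> cD; apply: (@continuous_subspaceW _ _ _ (closure (range E))).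
  exact: subIsetl.
exact/subspace_valL_continuousP'.
Qed.

Lemma compact_fst (X1 X2 : topologicalType) (K : set (X1 * X2)) :
  compact K -> compact (fst @` K).
Proof.
by apply: continuous_compact; apply: continuous_subspaceT => x; exact: cvg_fst.
Qed.

Lemma compact_snd (X1 X2 : topologicalType) (K : set (X1 * X2)) :
  compact K -> compact (snd @` K).
Proof.
by apply: continuous_compact; apply: continuous_subspaceT => x; exact: cvg_snd.
Qed.

(** The radius bounds the Euclidean norm, which dominates the maximum norm used in
    [truncated_range]. *)
Lemma near_truncated_range (R : realType) (T : topologicalType) (w : nat -> nat)
    (E : forall n, T -> 'rV[R]_(w n)) (r : nat -> R) (z : T) (K : set T) :
  (exists N : nat, forall n, (N <= n)%N ->
    (sup_over K (fun f => enorm (E n f)) <= (r n)%:E)%E) ->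
  \forall n \near \oo, forall f, K f -> truncated_range (E n) (r n) z (E n f).
Proof.
move=> [N Nr]; near=> n => f Kf.
apply/mem_truncated_range/(le_trans (normr_le_enorm _)).
rewrite -lee_fin (le_trans (le_sup_over (fun f => enorm (E n f)) Kf)) //.
by apply: Nr; near: n; exact: nbhs_infty_ge.
Unshelve. all: by end_near. Qed.

(** * Combining the decoding error with the approximation error *)

Theorem theorem5p6 (R : realType) (X1 X2 : metricType R)
    (w1 w2 : nat -> nat)
    (E1 : forall n, X1 -> 'rV[R]_(w1 n)) (E2 : forall n, X2 -> 'rV[R]_(w2 n))
    (hE1 : input_EDAP_with E1) (hE2 : input_EDAP_with E2)
    (F : forall a b : nat, set ('rV[R]_a -> 'rV[R]_b))
    (hF : universal_approximator F)
    (Y : completeNormedModType R) (S : set Y) (hS : dense S)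
    (G : X1 * X2 -> Y) (hG : continuous G)
    (K : set (X1 * X2)) (hK : compact K) :
  exists (p : nat -> nat)
         (phi1 : forall n, 'rV[R]_(w1 n) -> 'rV[R]_(p n))
         (phi2 : forall n, 'rV[R]_(w2 n) -> 'rV[R]_(p n))
         (psi : forall n, 'I_(p n) -> Y),
    [/\ forall n, (0 < p n)%N,
        forall n, F (w1 n) (p n) (phi1 n) /\ F (w2 n) (p n) (phi2 n),
        forall n i, S (psi n i) &
        sup_over K (fun f =>
            `| G f - \sum_(i < p n)
                 (phi1 n (E1 n f.1) ord0 i * phi2 n (E2 n f.2) ord0 i)
                   *: psi n i |)
          @[n --> \oo] --> 0%E].
Proof.
have [w10 [D1 [[r1 _ E1r] cD1 ED1]]] := hE1.
have [w20 [D2 [[r2 _ E2r] cD2 ED2]]] := hE2.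
(* An empty [K] offers no base point. The error bound is then vacuous, and approximating 0 on the
   empty set produces members of [F]. *)
have [->|/set0P[[z1 z2] Kz]] := eqVneq K set0.
  have F0 w : (0 < w)%N -> exists g, F w 1 g.
    move=> w0; have [||g Fg _] :=
      @universal_approximator_le R F w 1 set0 (fun=> 0) 1 hF w0 isT _ _ ltr01.
    - exact: compact0.
    - exact: continuous_subspace0.
    by exists g.
  have [s Ss _] := dense_norm_le 0 hS ltr01.
  exists (fun=> 1), (fun n => sval (cid (F0 _ (w10 n)))),
    (fun n => sval (cid (F0 _ (w20 n)))), (fun _ _ => s).
  split=> // [n|]; first by split; [case: cid|case: cid].
  by apply/sup_over_cvg0P => e e0; near=> n.
(* [z1] and [z2] are the default values of the extended decoders and keep the truncated ranges
   nonempty. *)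
have step n := separated_approximator hF hS hG (w10 n) (w20 n)
  (@compact_truncated_range _ _ _ (E1 n) (r1 n) z1)
  (@compact_truncated_range _ _ _ (E2 n) (r2 n) z2)
  (truncated_range_nonempty _ _ _) (truncated_range_nonempty _ _ _)
  (truncated_range_continuous (cD1 n)) (truncated_range_continuous (cD2 n))
  (harmonic_gt0 n).
have [p /dep_choice[phi1 /dep_choice[phi2 /dep_choice[psi stepP]]]] :=
  choice step.
exists p, phi1, phi2, psi; split=> [n|n|n|]; try by have [] := stepP n.
apply/sup_over_cvg0P => e e0.
have e20 : 0 < e / 2 by rewrite divr_gt0.
have [d d0 Gd] := compact_continuous_ball hK (fun x _ => hG x) e20.
(* The decoding bounds are non-strict while balls are open, hence [d / 2]. *)
have d20 : 0 < d / 2 by rewrite divr_gt0.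
have E1C := near_truncated_range z1 (E1r _ (compact_fst hK)).
have E2C := near_truncated_range z2 (E2r _ (compact_snd hK)).
have /sup_over_cvg0P/(_ _ d20) ED1d := ED1 _ (compact_fst hK).
have /sup_over_cvg0P/(_ _ d20) ED2d := ED2 _ (compact_snd hK).
have he : \forall n \near \oo, harmonic n <= e / 2.
  have /cvgr0Pnorm_le/(_ _ e20) := @cvg_harmonic R.
  by apply: filterS => n; apply: le_trans (ler_norm _).
near=> n => -[f1 f2] Kf /=.
have Kf1 : (fst @` K) f1 by exists (f1, f2).
have Kf2 : (snd @` K) f2 by exists (f1, f2).
have C1f : truncated_range (E1 n) (r1 n) z1 (E1 n f1).
  (* The point is generalized first, since the threshold on [n] must not depend on it. *)
  by move: f1 Kf1 {Kf}; near: n.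
have C2f : truncated_range (E2 n) (r2 n) z2 (E2 n f2).
  by move: f2 Kf2 {Kf}; near: n.
have f1d : mdist f1 (D1 n (to_closure_range (E1 n) f1)) <= d / 2.
  by move: f1 Kf1 {Kf C1f}; near: n.
have f2d : mdist f2 (D2 n (to_closure_range (E2 n) f2)) <= d / 2.
  by move: f2 Kf2 {Kf C2f}; near: n.
have [_ _ _ Gn] := stepP n.
have := Gn _ _ C1f C2f.
rewrite !valL_to_closure_range => {}Gn.
(* The intermediate point is [G] at the decoded pair: [Gd] bounds the first half, [Gn] with
   [harmonic n <= e / 2] the second. *)
apply: le_trans (ler_distD _ _ _) _; rewrite (splitr e).
apply: lerD (le_trans Gn _); last by near: n.
have /(Gd _ _ Kf) : ball (f1, f2) d (D1 n (to_closure_range (E1 n) f1),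
    D2 n (to_closure_range (E2 n) f2)).
  split; rewrite ballEmdist /=; [apply: le_lt_trans f1d _|apply: le_lt_trans f2d _];
    by rewrite ltr_pdivrMr // ltr_pMr // ltr1n.
by rewrite -ball_normE => /ltW.
Unshelve. all: by end_near. Qed.
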